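(* Let $n\ge1$, $\sigma>0$, $\boldsymbol\mu\in\mathcal S_n^\uparrow$, and observe $\mathbf y=\boldsymbol\mu+\boldsymbol\xi$ with $\boldsymbol\xi\sim\mathcal N(\mathbf 0,\sigma^2 I_{n\times n})$. Let $\hat k=k(\Pi_{\mathcal S_n^\uparrow}(\mathbf y))$. Then for every $\gamma\in(0,1)$, with probability at least $1-\gamma$, $$\hat k\le 2k(\boldsymbol\mu)\log\Big(\frac{en}{k(\boldsymbol\mu)}\Big)+7\log(1/\gamma),$$ and moreover $$\mathbb E_{\boldsymbol\mu}[\hat k]\le k(\boldsymbol\mu)\log\Big(\frac{en}{k(\boldsymbol\mu)}\Big).$$
   Context: $\mathcal S_n^\uparrow=\{\mathbf u\in\mathbb R^n: u_1\le\dots\le u_n\}$ ($\mathcal S_1^\uparrow=\mathbb R$). $\Pi_{\mathcal S_n^\uparrow}$ is the Euclidean projection onto $\mathcal S_n^\uparrow$ (the least squares estimator). For $\mathbf u\in\mathbb R^n$, $k(\mathbf u)=|\{u_1,\dots,u_n\}|$, the number of distinct values (for nondecreasing $\mathbf u$, the number of constant pieces). $\mathbb E_{\boldsymbol\mu}$ is expectation under $\mathbf y=\boldsymbol\mu+\boldsymbol\xi$. *)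

(* Defs.v *)
From HB Require Import structures.
From mathcomp Require Import all_boot all_order all_algebra.
From mathcomp Require Import all_classical all_reals all_analysis.
Set Implicit Arguments. Unset Strict Implicit. Unset Printing Implicit Defensive.
Import Order.TTheory GRing.Theory Num.Theory.
Local Open Scope classical_set_scope.
Local Open Scope ring_scope.

Definition monotone_cone {R : realType} (n : nat) : set ('I_n -> R) :=
  [set u | forall i j : 'I_n, (i <= j)%N -> u i <= u j].

Definition sqdist {R : realType} (n : nat) (u v : 'I_n -> R) : R :=
  \sum_(i < n) (u i - v i) ^+ 2.

Definition is_mono_proj {R : realType} (n : nat) (y x : 'I_n -> R) : Prop :=
  monotone_cone x /\ forall z, monotone_cone z -> sqdist y x <= sqdist y z.

(* The least squares estimator Pi_{S_n^up}(y) (the minimizer exists and is unique) *)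
Definition mono_proj {R : realType} (n : nat) (y : 'I_n -> R) : 'I_n -> R :=
  xget (fun _ => 0) [set x | is_mono_proj y x].

Definition nb_distinct {R : realType} (n : nat) (u : 'I_n -> R) : nat :=
  size (undup [seq u i | i <- enum 'I_n]).

(* Main.v *)
Require Import Defs.
From HB Require Import structures.
From mathcomp Require Import all_boot all_order all_algebra.
From mathcomp Require Import all_classical all_reals all_analysis.
From mathcomp Require Import fingroup perm measurable_realfun ring lra zify.
Import Order.TTheory GRing.Theory Num.Theory.
Local Open Scope classical_set_scope.
Local Open Scope ring_scope.

(** The number of distinct values of the projection is the number of faces of the
    greatest convex minorant of the partial sums of [y] (pool adjacent violators).
    A vertex of this minorant remains a vertex when the data are restricted to a piece,
    so [khat] is at most the sum, over the constant pieces of [mu], of the numbers of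
    faces of the pieces, and on a piece only the noise matters.

    The noise is exchangeable, so expectations may be averaged over permutations.
    Averaged over all arrangements of [m] generic numbers, [z ^+ nb_faces] is at most
    [f_m = \prod_(i < m) (i + z) / i.+1], as for cycles of a random permutation: marking
    a position, cutting out the face that covers it, rotating this face to start at the
    mark and moving it to the end is injective, because a face has a unique admissible
    rotation and a unique admissible place; hence [m f_m <= z \sum_(i < m) f_i].
    Ties are removed by a small perturbation, which can only create faces.

    With [f_m <= exp ((z - 1) (1 + ln m))] and the concavity of [ln] this gives
    [E (z ^+ khat) <= exp ((z - 1) C)], where [C = k ln (e n / k)]. Markov's inequality
    at [z = 2] yields the deviation bound, and letting [z] tend to [1] the mean. *)

Lemma sub_in_count (A : eqType) (a1 a2 : pred A) (s : seq A) :
  {in s, subpred a1 a2} -> (count a1 s <= count a2 s)%N.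
Proof.
elim: s => [//|i s IH] /= h; apply: leq_add.
  by case: (a1 i) (h i (mem_head _ _)) => // ->.
by apply: IH => j js; apply: h; rewrite inE js orbT.
Qed.

(** * Blocks of the greatest convex minorant *)

Section Blocks.
Variables (R : realFieldType) (I : eqType).
Implicit Types (x : I -> R) (s t u v w : seq I) (ws : seq (seq I)) (c : R).

Definition mean x s : R := (\sum_(i <- s) x i) / (size s)%:R.

Definition dev x c s : R := \sum_(i <- s) (x i - c).

Lemma devE x c s : dev x c s = \sum_(i <- s) x i - c * (size s)%:R.
Proof.
by rewrite /dev sumrB big_const_seq count_predT iter_addr_0 mulr_natr.
Qed.

Lemma dev_cat x c u v : dev x c (u ++ v) = dev x c u + dev x c v.
Proof. exact: big_cat. Qed.

Lemma size_gt0R s : s != [::] -> 0 < (size s)%:R :> R.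
Proof. by rewrite ltr0n lt0n size_eq0. Qed.

Lemma lt_mean x c s : s != [::] -> (c < mean x s) = (0 < dev x c s).
Proof. by move=> /size_gt0R s0; rewrite devE subr_gt0 ltr_pdivlMr. Qed.

Lemma mean_lt x c s : s != [::] -> (mean x s < c) = (dev x c s < 0).
Proof. by move=> /size_gt0R s0; rewrite devE subr_lt0 ltr_pdivrMr. Qed.

Lemma le_mean x c s : s != [::] -> (c <= mean x s) = (0 <= dev x c s).
Proof. by move=> s0; rewrite leNgt mean_lt// -leNgt. Qed.

Lemma mean_le x c s : s != [::] -> (mean x s <= c) = (dev x c s <= 0).
Proof. by move=> s0; rewrite leNgt lt_mean// -leNgt. Qed.

Lemma dev_mean x s : dev x (mean x s) s = 0.
Proof.
have [->|s0] := eqVneq s [::]; first by rewrite /dev big_nil.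
by apply/eqP; rewrite eq_le -mean_le// -le_mean// lexx.
Qed.

Lemma cat_neq0l u v : u != [::] -> u ++ v != [::].
Proof. by case: u. Qed.

Lemma cat_neq0r u v : v != [::] -> u ++ v != [::].
Proof. by case: u. Qed.

Lemma mean_map (J : eqType) x (f : J -> I) (s : seq J) :
  mean x (map f s) = (\sum_(i <- s) x (f i)) / (size s)%:R.
Proof. by rewrite /mean big_map size_map. Qed.

(** The cut between [u] and [v] is a vertex of the minorant. Testing finitely many lengths makes
    this a boolean that can be counted and shown measurable; [b.+1] skips the empty prefix, and an
    empty [v] passes vacuously. *)
Definition separated x u v : bool :=
  all (fun a => all (fun b => mean x (drop a u) < mean x (take b.+1 v))
                    (iota 0 (size v))) (iota 0 (size u)).

Lemma separatedP x u v : reflect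
  (forall u1 u2 v1 v2, u = u1 ++ u2 -> v = v1 ++ v2 -> u2 != [::] -> v1 != [::] ->
     mean x u2 < mean x v1) (separated x u v).
Proof.
apply: (iffP idP) => [h u1 u2 v1 v2 eu ev u0 v0|h].
  move/allP: h => /(_ (size u1)); rewrite mem_iota eu size_cat /= add0n.
  have /size_gt0R := u0; have /size_gt0R := v0; rewrite !ltr0n => v1s u2s.
  rewrite -[X in (X < _)%N]addn0 ltn_add2l => /(_ u2s) /allP/(_ (size v1).-1).
  rewrite mem_iota ev size_cat add0n prednK// leq_addr => /(_ isT).
  by rewrite drop_size_cat// take_size_cat.
apply/allP => a; rewrite mem_iota add0n => /= ha; apply/allP => b.
rewrite mem_iota add0n => /= hb.
apply: (h (take a u) (drop a u) (take b.+1 v) (drop b.+1 v)); rewrite ?cat_take_drop//.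
  by rewrite -size_eq0 size_drop; lia.
by rewrite -size_eq0 size_take; case: ifP; lia.
Qed.

(* Every index up to [size t] is tested and [i = size t] always counts, so this is the
   number of faces and not the number of interior vertices. *)
Definition nb_faces x t : nat :=
  count (fun i => separated x (take i t) (drop i t)) (iota 1 (size t)).

(** The partial sums over [w] stay on or above their chord: the shape of a single face, with ties
    allowed inside it. *)
Definition irreducible x w : Prop :=
  w != [::] /\ forall a b, w = a ++ b -> a != [::] -> b != [::] -> mean x b <= mean x a.

Lemma irreducible_suffix x a b : irreducible x (a ++ b) -> b != [::] -> mean x b <= mean x (a ++ b).
Proof.
move=> [w0 h] b0; have [->|a0] := eqVneq a [::]; first by [].
have := h _ _ erefl a0 b0 => hab.
have := dev_mean x (a ++ b); rewrite dev_cat => e.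
rewrite leNgt; apply/negP => hl.
have ha : mean x (a ++ b) < mean x a by apply: lt_le_trans hab.
by move: hl ha; rewrite !lt_mean//; lra.
Qed.

Lemma irreducible_prefix x a b : irreducible x (a ++ b) -> a != [::] -> mean x (a ++ b) <= mean x a.
Proof.
move=> [w0 h] a0; have [->|b0] := eqVneq b [::]; first by rewrite cats0.
have := h _ _ erefl a0 b0 => hab.
have := dev_mean x (a ++ b); rewrite dev_cat => e.
rewrite leNgt; apply/negP => hl.
have ha : mean x b < mean x (a ++ b) by apply: le_lt_trans hl.
by move: hl ha; rewrite !mean_lt//; lra.
Qed.

Lemma cat_eq_cases a b u v : a ++ b = u ++ v ->
  (exists2 c, u = a ++ c & b = c ++ v) \/
  (exists2 c, a = u ++ c & c != [::] /\ v = c ++ b).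
Proof.
elim: a u => [|i a IH] u /=; first by move=> ->; left; exists u.
case: u => [|j u] /=; first by move=> <-; right; exists (i :: a).
move=> [<- /IH[[c -> ->]|[c -> [c0 ->]]]]; first by left; exists c.
by right; exists c.
Qed.

(** Any cut leaves one side within a single block. Measured from the mean of that side, both parts
    of the other side deviate in the same direction. *)
Lemma irreducible_cat x u v : irreducible x u -> irreducible x v ->
  mean x v <= mean x u -> irreducible x (u ++ v).
Proof.
move=> iu iv vu; have [u0 hu] := iu; have [v0 hv] := iv.
split=> [|a b /esym e a0 b0]; first exact: cat_neq0l.
have [[c ec eb]|[c ea [c0 ev]]] := cat_eq_cases _ _ _ _ e; last first.
  have h1 : mean x b <= mean x v by rewrite ev; apply: irreducible_suffix; rewrite -?ev.
  have h2 : mean x v <= mean x c by rewrite ev; apply: irreducible_prefix; rewrite -?ev.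
  rewrite ea le_mean ?cat_neq0l// dev_cat addr_ge0// -le_mean//.
    exact: le_trans vu.
  exact: le_trans h2.
have h1 : mean x u <= mean x a by rewrite ec; apply: irreducible_prefix; rewrite -?ec.
rewrite eb mean_le ?cat_neq0r// dev_cat; have [->|c0] := eqVneq c [::].
  by rewrite /dev big_nil add0r -/(dev _ _ _) -mean_le//; apply: le_trans h1.
have h2 : mean x c <= mean x u by rewrite ec; apply: irreducible_suffix; rewrite -?ec.
by rewrite -lerN2 oppr0 opprD addr_ge0// oppr_ge0 -mean_le//; lra.
Qed.

Definition faces x ws : Prop :=
  (forall w, w \in ws -> irreducible x w) /\ sorted (fun u v => mean x u < mean x v) ws.

Lemma mean_lt_trans x : transitive (fun u v => mean x u < mean x v).
Proof. by move=> a b c; apply: lt_trans. Qed.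

Lemma faces_cons x w ws : faces x (w :: ws) ->
  [/\ irreducible x w, faces x ws & forall v, v \in ws -> mean x w < mean x v].
Proof.
move=> [h1 /= h2]; split; first by apply: h1; rewrite inE eqxx.
  by split=> [v vw|]; [apply: h1; rewrite inE vw orbT|apply: path_sorted h2].
by move=> v vw; have /allP/(_ v vw) := order_path_min (@mean_lt_trans x) h2.
Qed.

(** The prefix consists of whole faces and an initial part of one more; by irreducibility each of
    these has mean above [c]. *)
Lemma faces_prefix x ws c p q : faces x ws -> (forall w, w \in ws -> c < mean x w) ->
  flatten ws = p ++ q -> p != [::] -> c < mean x p.
Proof.
elim: ws p => [|w ws IH] p; first by case: p.
move=> /faces_cons[iw gws _] hc /= e p0.
have cw : c < mean x w by apply: hc; rewrite inE eqxx.
have [[a ep ef]|[a ep [a0 ef]]] := cat_eq_cases _ _ _ _ e; last first.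
  by apply: lt_le_trans cw _; rewrite ep; apply: irreducible_prefix; rewrite -?ep.
have w0 := proj1 iw; rewrite ep lt_mean ?cat_neq0l// dev_cat.
have [->|a0] := eqVneq a [::]; first by rewrite {2}/dev big_nil addr0 -lt_mean.
rewrite addr_gt0 -?lt_mean//; apply: IH ef a0 => // v vw.
by apply: hc; rewrite inE vw orbT.
Qed.

Lemma faces_separated x w ws : faces x (w :: ws) -> separated x w (flatten ws).
Proof.
move=> /faces_cons[iw gws hw]; apply/separatedP => u1 u2 v1 v2 eu ev u0 v0.
have h : mean x u2 <= mean x w by rewrite eu; apply: irreducible_suffix; rewrite -?eu.
by apply: le_lt_trans h _; apply: faces_prefix ev v0.
Qed.

(** Behind a vertex, [w] no longer matters: a suffix [c] of [w] has mean below that of [u ++ v1],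
    hence below that of [v1], so prefixing [u] with [c] cannot lift its mean to that of [v1]. *)
Lemma separated_catl x w u v : separated x w (u ++ v) -> u != [::] ->
  separated x (w ++ u) v = separated x u v.
Proof.
move=> /separatedP hw u0.
apply/idP/idP => /separatedP h; apply/separatedP => u1 u2 v1 v2 eu ev u20 v0.
  by apply: (h (w ++ u1) u2 v1 v2); rewrite // -catA -eu.
have [[c ec euc]|[c ec [c0 euc]]] := cat_eq_cases _ _ _ _ eu.
  exact: (h c u2 v1 v2).
have h1 : mean x c < mean x (u ++ v1).
  by apply: (hw u1 c (u ++ v1) v2); rewrite // -?catA -?ev//; apply: cat_neq0r.
have h2 : mean x u < mean x v1 by apply: (h [::] u v1 v2).
have h3 : mean x (u ++ v1) < mean x v1.
  by move: (h2); rewrite !mean_lt ?cat_neq0r// dev_cat dev_mean addr0.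
have h4 : mean x c < mean x v1 by apply: lt_trans h1 h3.
by rewrite euc mean_lt ?cat_neq0l// dev_cat; move: h2 h4; rewrite !mean_lt//; lra.
Qed.

(** Irreducibility excludes vertices inside the first block, [faces_separated] puts one at its end,
    and [separated_catl] reduces later cuts to the remaining blocks. *)
Lemma nb_faces_flatten x ws : faces x ws -> nb_faces x (flatten ws) = size ws.
Proof.
elim: ws => [//|w ws IH] g; have [iw gws hw] := faces_cons _ _ _ g.
have sw := faces_separated _ _ _ g; have [w0 hi] := iw.
rewrite /nb_faces /= size_cat iotaD count_cat -IH//.
have w1 : (0 < size w)%N by rewrite lt0n size_eq0.
have ew : size w = ((size w).-1 + 1)%N by rewrite addn1 prednK.
rewrite [X in iota 1 X]ew iotaD count_cat.
rewrite (_ : count _ (iota 1 (size w).-1) = 0)%N; last first.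
  apply/eqP; rewrite -leqn0 leqNgt -has_count; apply/negP => /hasP[j].
  rewrite mem_iota => hj /separatedP hs; have jl : (j < size w)%N by lia.
  have t0 : take j w != [::] by rewrite -size_eq0 size_takel ?(ltnW jl)//; lia.
  have d0 : drop j w != [::] by rewrite -size_eq0 size_drop; lia.
  have := hi (take j w) (drop j w).
  rewrite cat_take_drop => /(_ erefl t0 d0); rewrite leNgt => /negP; apply.
  apply: (hs [::] _ _ (flatten ws)) => //.
    by rewrite takel_cat// ltnW.
  by rewrite drop_cat jl.
rewrite add1n prednK//= addn0 add0n drop_size_cat// take_size_cat// sw add1n.
congr S; rewrite -[(size w).+1]addn1 iotaDl count_map; apply: eq_in_count => j.
rewrite mem_iota => hj /=; rewrite take_cat drop_cat.
rewrite [(_ + j < _)%N]ltnNge leq_addr /= addKn.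
by apply: separated_catl; rewrite ?cat_take_drop// -size_eq0 size_takel; lia.
Qed.

(** If the first blocks differed, the longer one would contain the vertex that ends the shorter,
    against irreducibility. *)
Lemma faces_unique x ws1 ws2 : faces x ws1 -> faces x ws2 ->
  flatten ws1 = flatten ws2 -> ws1 = ws2.
Proof.
have aux (u1 u2 c : seq I) (v1 v2 : seq (seq I)) : faces x (u1 :: v1) -> faces x (u2 :: v2) ->
    u2 = u1 ++ c -> flatten v1 = c ++ flatten v2 -> c = [::].
  move=> g1 g2 eu ev; apply/eqP/negPn/negP => c0.
  have /separatedP/(_ [::] u1 c (flatten v2) erefl ev) := faces_separated _ _ _ g1.
  have [[u0 _] _ _] := faces_cons _ _ _ g1; have [[_ h] _ _] := faces_cons _ _ _ g2.
  by move=> /(_ u0 c0); rewrite ltNge (h _ _ eu u0 c0).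
elim: ws1 ws2 => [|w1 ws1 IH] [|w2 ws2] //= g1 g2 e.
- have [[w0 _] _ _] := faces_cons _ _ _ g2.
  by have := cat_neq0l _ (flatten ws2) w0; rewrite -e.
- have [[w0 _] _ _] := faces_cons _ _ _ g1.
  by have := cat_neq0l _ (flatten ws1) w0; rewrite e.
have [_ k1 _] := faces_cons _ _ _ g1; have [_ k2 _] := faces_cons _ _ _ g2.
have [[c ec ef]|[c ec [c0 ef]]] := cat_eq_cases _ _ _ _ e.
  have c0 := aux _ _ _ _ _ g1 g2 ec ef.
  by move: ec ef; rewrite c0 cats0 /= => -> /IH ->.
by have := aux _ _ _ _ _ g2 g1 ec ef => ce; rewrite ce in c0.
Qed.

(** Pool adjacent violators: [w] absorbs the following blocks until the next mean is strictly
    larger, so equal means are pooled too. *)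
Fixpoint pava_insert x w ws : seq (seq I) :=
  if ws is v :: ws' then
    if mean x w < mean x v then w :: ws else pava_insert x (w ++ v) ws'
  else [:: w].

Fixpoint pava x s : seq (seq I) :=
  if s is i :: s' then pava_insert x [:: i] (pava x s') else [::].

Lemma pava_insert_flatten x w ws : flatten (pava_insert x w ws) = w ++ flatten ws.
Proof.
elim: ws w => [//|v ws IH] w /=; case: ifP => // _.
by rewrite IH catA.
Qed.

Lemma pava_insert_faces x w ws : irreducible x w -> faces x ws -> faces x (pava_insert x w ws).
Proof.
elim: ws w => [|v ws IH] w iw; first by split=> // v; rewrite inE => /eqP ->.
move=> g; have [iv gws hv] := faces_cons _ _ _ g => /=; case: ltP => h; last first.
  by apply: IH => //; apply: irreducible_cat.
split=> [u|/=]; first by rewrite inE => /orP[/eqP -> //|]; apply: (proj1 g).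
by rewrite h; apply: (proj2 g).
Qed.

Lemma pava_flatten x s : flatten (pava x s) = s.
Proof. by elim: s => [//|i s IH] /=; rewrite pava_insert_flatten IH. Qed.

Lemma pava_faces x s : faces x (pava x s).
Proof.
elim: s => [|i s IH] /=; first by [].
apply: pava_insert_faces => //; split=> // a b e a0 b0.
by move/(congr1 size): e; move: a b a0 b0 => [|? ?] [|? ?] //= _ _; rewrite size_cat /=; lia.
Qed.

(** Restriction to [u] or [v] leaves fewer pairs of means to compare at each cut, so vertices
    survive. *)
Lemma nb_faces_cat x u v : (nb_faces x (u ++ v) <= nb_faces x u + nb_faces x v)%N.
Proof.
rewrite /nb_faces size_cat iotaD count_cat leq_add//.
  apply: sub_in_count => i; rewrite mem_iota => hi /separatedP h.
  apply/separatedP => u1 u2 v1 v2 eu ev; apply: (h u1 u2 v1 (v2 ++ v)).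
    by rewrite takel_cat//; lia.
  rewrite catA -ev drop_cat; case: ltnP => // h1.
  by rewrite (_ : i = size u) ?subnn ?drop0 ?drop_size//; lia.
rewrite addnC iotaDl count_map.
apply: sub_in_count => i; rewrite mem_iota => hi /= /separatedP h.
apply/separatedP => u1 u2 v1 v2 eu ev; apply: (h (u ++ u1) u2 v1 v2).
  by rewrite take_cat ltnNge leq_addr /= addKn eu catA.
by rewrite drop_cat ltnNge leq_addr /= addKn ev.
Qed.

Lemma separated_homo x y u v :
  (forall a b, a != [::] -> b != [::] -> {subset a <= u} -> {subset b <= v} ->
    uniq a -> uniq b -> mean x a < mean x b -> mean y a < mean y b) ->
  uniq u -> uniq v -> separated x u v -> separated y u v.
Proof.
move=> h uu uv /separatedP hs; apply/separatedP => u1 u2 v1 v2 eu ev u0 v0.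
apply: h => //; last exact: (hs _ _ _ _ eu ev).
- by move=> i iu; rewrite eu mem_cat iu orbT.
- by move=> i iu; rewrite ev mem_cat iu.
- by move: uu; rewrite eu cat_uniq => /and3P[].
- by move: uv; rewrite ev cat_uniq => /and3P[].
Qed.

Lemma nb_faces_homo x y t :
  (forall a b, a != [::] -> b != [::] -> {subset a <= t} -> {subset b <= t} ->
    uniq a -> uniq b -> mean x a < mean x b -> mean y a < mean y b) ->
  uniq t -> (nb_faces x t <= nb_faces y t)%N.
Proof.
move=> h ut; apply: sub_count => i; apply: separated_homo; rewrite ?take_uniq ?drop_uniq//.
move=> a b a0 b0 ha hb; apply: h => // j ?; [apply/mem_take/ha|apply/mem_drop/hb] => //.
Qed.

End Blocks.

Arguments mean {R I}.
Arguments dev {R I}.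
Arguments separated {R I}.
Arguments nb_faces {R I}.
Arguments irreducible {R I}.
Arguments faces {R I}.
Arguments pava {R I}.

Lemma nb_faces_map (R : realFieldType) (I J : eqType) (x : I -> R) (f : J -> I) (s : seq J) :
  nb_faces x (map f s) = nb_faces (x \o f) s.
Proof.
rewrite /nb_faces size_map; apply: eq_count => i; rewrite -map_take -map_drop /separated !size_map.
apply: eq_all => a; apply: eq_all => b; rewrite -map_drop -map_take.
by rewrite !mean_map.
Qed.

(** * Comparison of finite sums along an injection *)

Section SumInj.
Variable R : realFieldType.

Lemma ler_sum_uniq_sub (A : eqType) (s1 s2 : seq A) (G : A -> R) :
  (forall a, 0 <= G a) -> uniq s1 -> {subset s1 <= s2} ->
  \sum_(a <- s1) G a <= \sum_(a <- s2) G a.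
Proof.
move=> G0; elim: s1 s2 => [|a s1 IH] s2 /=; first by rewrite big_nil sumr_ge0.
move=> /andP[as1 us1] sub.
have as2 : a \in s2 by apply: sub; rewrite inE eqxx.
rewrite (perm_big _ (perm_to_rem as2)) !big_cons lerD2l; apply: IH => // b bs1.
have : b \in s2 by apply: sub; rewrite inE bs1 orbT.
rewrite (perm_mem (perm_to_rem as2)) inE => /orP[/eqP ba|//].
by rewrite -ba bs1 in as1.
Qed.

Lemma ler_sum_inj (A B : eqType) (s1 : seq A) (s2 : seq B) (f : A -> B)
    (F : A -> R) (G : B -> R) :
  uniq s1 -> {in s1 &, injective f} -> (forall a, a \in s1 -> f a \in s2) ->
  (forall b, 0 <= G b) -> (forall a, a \in s1 -> F a <= G (f a)) ->
  \sum_(a <- s1) F a <= \sum_(b <- s2) G b.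
Proof.
move=> us1 fi fs G0 FG; apply: (@le_trans _ _ (\sum_(a <- s1) G (f a))).
  by rewrite big_seq [leRHS]big_seq; apply: ler_sum.
rewrite -(big_map f xpredT G); apply: ler_sum_uniq_sub => //.
  by rewrite map_inj_in_uniq.
by move=> b /mapP[a /fs ? ->].
Qed.

End SumInj.

(** * The permutation average *)

Section Recursion.
Variables (R : realFieldType) (I : eqType).
Implicit Types (x : I -> R) (s t u v w : seq I) (ws : seq (seq I)).

Definition generic x : Prop :=
  forall u v, u != [::] -> v != [::] -> uniq (u ++ v) -> mean x u != mean x v.

(** A proper rotation exchanges two arcs of [w1]. Irreducibility of both arrangements forces equal
    means on the arcs, which genericity forbids. *)
Lemma irreducible_rot_eq x w1 w2 r1 r2 : generic x -> uniq w1 ->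
  irreducible x w1 -> irreducible x w2 ->
  rot r1 w1 = rot r2 w2 -> w1 = w2.
Proof.
move=> gx u1 i1 i2 e.
have {}e : w2 = rot (rot_add w1 r1 (size (rot r1 w1) - r2)) w1.
  by rewrite -rot_rot_add -[LHS](rotK r2) -e.
move: (rot_add _ _ _) e => m e.
have ew : w1 = take m w1 ++ drop m w1 by rewrite cat_take_drop.
have [t0|t0] := eqVneq (take m w1) [::].
  by rewrite e /rot {1}ew t0 cats0.
have [d0|d0] := eqVneq (drop m w1) [::].
  by rewrite e /rot {1}ew d0 cats0.
have h1 := proj2 i1 _ _ ew t0 d0; have h2 := proj2 i2 _ _ e d0 t0.
have := gx _ _ t0 d0; rewrite -ew => /(_ u1).
by rewrite eq_le h1 h2.
Qed.

Lemma rot_inj_uniq w r1 r2 : uniq w -> (r1 < size w)%N -> (r2 < size w)%N ->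
  rot r1 w = rot r2 w -> r1 = r2.
Proof.
case: w => [//|i w]; set w' := i :: w => uw h1 h2 e.
have h r : (r < size w')%N -> head i (rot r w') = nth i w' r.
  by move=> hr; rewrite /rot (drop_nth i).
by apply/eqP; rewrite -(nth_uniq i h1 h2 uw) -!h// e.
Qed.

Lemma faces_remove x ws1 w ws2 : faces x (ws1 ++ w :: ws2) -> faces x (ws1 ++ ws2).
Proof.
have sub : subseq (ws1 ++ ws2) (ws1 ++ w :: ws2).
  by rewrite subseq_cat2l subseq_cons.
move=> [h1 h2]; split=> [v /(mem_subseq sub)/h1//|].
by apply: (subseq_sorted (@mean_lt_trans _ _ x)) h2.
Qed.

(** With two different places, some block would follow [w] in one list and precede it in the other,
    although means strictly increase. *)
Lemma faces_insert_unique x us vs us' vs' w : faces x (us ++ w :: vs) ->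
  faces x (us' ++ w :: vs') -> us ++ vs = us' ++ vs' -> us = us' /\ vs = vs'.
Proof.
have aux us1 vs1 us2 vs2 : faces x (us1 ++ w :: vs1) ->
    faces x (us2 ++ w :: vs2) -> us1 ++ vs1 = us2 ++ vs2 -> ~~ (size us1 < size us2)%N.
  move=> g1 g2 e; apply/negP => h.
  have /(congr1 (drop (size us1))) := e.
  rewrite drop_size_cat// drop_cat h; case ed : (drop (size us1) us2) => [|a us3] ev.
    by move/(congr1 size): ed; rewrite size_drop /=; lia.
  have ha : a \in us2 by apply: (@mem_drop (size us1)); rewrite ed inE eqxx.
  have g1' := @subseq_sorted _ _ (@mean_lt_trans _ _ x) [:: w; a] _ _ (proj2 g1).
  have g2' := @subseq_sorted _ _ (@mean_lt_trans _ _ x) [:: a; w] _ _ (proj2 g2).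
  have : mean x w < mean x a.
    have /= := g1' _; rewrite andbT; apply; rewrite ev -[[:: w; a]]cat0s.
    by rewrite cat_subseq ?sub0seq//= eqxx eqxx sub0seq.
  have : mean x a < mean x w.
    have /= := g2' _; rewrite andbT; apply; rewrite -[[:: a; w]]/([:: a] ++ [:: w]).
    by rewrite cat_subseq// ?sub1seq// inE eqxx.
  by move=> /lt_trans /[apply]; rewrite ltxx.
move=> g1 g2 e; have es : size us = size us'.
  have := aux _ _ _ _ g1 g2 e; have := aux _ _ _ _ g2 g1 (esym e); lia.
have /eqP := e; rewrite eqseq_cat// => /andP[/eqP -> /eqP ->]//.
Qed.

Lemma block_split ws p : (p < size (flatten ws))%N ->
  let k := reshape_index (shape ws) p in let w := nth [::] ws k in
  let r := reshape_offset (shape ws) p in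
  [/\ ws = take k ws ++ w :: drop k.+1 ws, (r < size w)%N &
      p = (size (flatten (take k ws)) + r)%N].
Proof.
rewrite size_flatten => hp k w r.
have hk : (k < size ws)%N by have := reshape_indexP hp; rewrite size_map.
split.
- by rewrite -drop_nth// cat_take_drop.
- by have := reshape_offsetP hp; rewrite (nth_map [::]).
- rewrite -[LHS](reshape_indexK (shape ws)) /flatten_index size_flatten.
  by rewrite /shape map_take.
Qed.

(* Cut out the block of [take j t] covering position [p], rotate it to start at [p],
   and move it to the end of the first [j] entries. *)
Definition cut_rotate x (j : nat) (tp : seq I * nat) : nat * seq I :=
  let ws := pava x (take j tp.1) in
  let k := reshape_index (shape ws) tp.2 in
  let w := nth [::] ws k in
  (size w, flatten (take k ws ++ drop k.+1 ws) ++
           rot (reshape_offset (shape ws) tp.2) w ++ drop j tp.1).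

Lemma cut_rotate_spec x j t p : (p < j)%N -> (j <= size t)%N ->
  exists us w vs r,
  [/\ faces x (us ++ w :: vs), take j t = flatten (us ++ w :: vs),
      (r < size w)%N, p = (size (flatten us) + r)%N &
      cut_rotate x j (t, p) = (size w, flatten (us ++ vs) ++ rot r w ++ drop j t)].
Proof.
move=> pj jt; rewrite /cut_rotate /=; set ws := pava x _.
have fws : flatten ws = take j t by rewrite pava_flatten.
have [|e hr hp] := @block_split ws p; first by rewrite fws size_takel.
set k := reshape_index _ _ in e hr hp *; set w := nth _ _ _ in e hr *.
exists (take k ws), w, (drop k.+1 ws), (reshape_offset (shape ws) p).
by rewrite -e; split=> //; apply: pava_faces.
Qed.

Lemma cut_rotate_perm x j t p : (p < j)%N -> (j <= size t)%N ->
  perm_eq (cut_rotate x j (t, p)).2 t.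
Proof.
move=> pj jt; have [us [w [vs [r [_ et _ _ ->]]]]] := cut_rotate_spec x j t p pj jt.
rewrite /= -[X in perm_eq _ X](cat_take_drop j) et !flatten_cat /= !catA perm_cat2r.
rewrite -!catA perm_cat2l perm_catC perm_cat2r.
by rewrite perm_rot.
Qed.

(** The face length tells where to split the output; uniqueness of the rotation returns the face and
    the offset, [faces_unique] the other faces, and [faces_insert_unique] the place of the face,
    hence the mark. *)
Lemma cut_rotate_inj x j t p t' p' : generic x -> uniq t ->
  (p < j)%N -> (j <= size t)%N -> (p' < j)%N -> (j <= size t')%N ->
  cut_rotate x j (t, p) = cut_rotate x j (t', p') -> t = t' /\ p = p'.
Proof.
move=> gx ut pj jt pj' jt'.
have [us [w [vs [r [g et rw -> ->]]]]] := cut_rotate_spec x j t p pj jt.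
have [us' [w' [vs' [r' [g' et' rw' -> ->]]]]] := cut_rotate_spec x j t' p' pj' jt'.
move=> [ew /eqP].
have st : size (flatten (us ++ w :: vs)) = size (flatten (us' ++ w' :: vs')).
  by rewrite -et -et' !size_takel.
rewrite eqseq_cat; last first.
  by move: st; rewrite !flatten_cat /= !size_cat; lia.
rewrite eqseq_cat ?size_rot// => /and3P[/eqP ef /eqP er /eqP ed].
have irrw : irreducible x w by apply: (proj1 g); rewrite mem_cat inE eqxx orbT.
have irrw' : irreducible x w' by apply: (proj1 g'); rewrite mem_cat inE eqxx orbT.
have uw : uniq w.
  have := take_uniq j ut.
  by rewrite et flatten_cat /= !cat_uniq => /and3P[_ _ /and3P[]].
have eww := irreducible_rot_eq _ _ _ _ _ gx uw irrw irrw' er.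
rewrite -eww in er g' et' rw' *.
have <- := rot_inj_uniq _ _ _ uw rw rw' er.
have [eu ev] := faces_insert_unique _ _ _ _ _ _ g g'
  (faces_unique _ _ _ _ _ (faces_remove _ _ _ _ g) (faces_remove _ _ _ _ g') ef).
split; last by rewrite eu.
by rewrite -(cat_take_drop j t) -(cat_take_drop j t') ed et et' eu ev.
Qed.

(** The mean of [z ^+ c], where [c] is the number of cycles of a uniform random permutation of [j]
    points. *)
Definition faces_mgf (z : R) (j : nat) : R := \prod_(i < j) ((i%:R + z) / i.+1%:R).

Lemma faces_mgf_sum z j : j%:R * faces_mgf z j = z * \sum_(i < j) faces_mgf z i.
Proof.
elim: j => [|j IH]; first by rewrite big_ord0 !mul0r mulr0.
rewrite big_ord_recr /= mulrDr -IH /faces_mgf big_ord_recr /= -/(faces_mgf z j).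
have : j.+1%:R != 0 :> R by rewrite pnatr_eq0.
by move=> h; field; rewrite addrC natr1.
Qed.

(** The induction runs over all weights [H] of the tail at once, because a face moved behind the
    prefix joins the tail. The weight later carries the remaining pieces. *)
Lemma sum_nb_faces_prefix x (z : R) s j (H : seq I -> R) :
  generic x -> 0 <= z -> uniq s -> (j <= size s)%N -> (forall v, 0 <= H v) ->
  \sum_(t <- permutations s) z ^+ nb_faces x (take j t) * H (drop j t) <=
  faces_mgf z j * \sum_(t <- permutations s) H (drop j t).
Proof.
move=> gx z0 us; elim/ltn_ind: j H => J IH H js H0; have [->|J1] := posnP J.
  rewrite /faces_mgf big_ord0 mul1r; apply: ler_sum => t _.
  by rewrite take0 /nb_faces /= expr0 mul1r.
set B := \sum_(t <- _) H _.
have J0 : 0 < J%:R :> R by rewrite ltr0n.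
rewrite -(ler_pM2l J0) mulrA faces_mgf_sum.
have permP t : t \in permutations s -> uniq t /\ size t = size s.
  by rewrite mem_permutations => h; rewrite (perm_uniq h) (perm_size h).
(* The pair holds the length of the removed face and the new arrangement; the leading [z] accounts
   for that face. *)
pose G (lt : nat * seq I) := z * (z ^+ nb_faces x (take (J - lt.1) lt.2) * H (drop J lt.2)).
apply: (@le_trans _ _ (\sum_(lt <- [seq (l, t) | l <- iota 1 J, t <- permutations s]) G lt)).
  (* The factor [J] becomes the choice of a marked position. *)
  have -> : J%:R * \sum_(t <- permutations s) z ^+ nb_faces x (take J t) * H (drop J t) =
    \sum_(tp <- [seq (t, p) | t <- permutations s, p <- iota 0 J])
      z ^+ nb_faces x (take J tp.1) * H (drop J tp.1).
    rewrite big_allpairs_dep /= mulr_sumr; apply: eq_bigr => t _.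
    by rewrite big_const_seq count_predT size_iota iter_addr_0 mulr_natl.
  apply: (@ler_sum_inj _ _ _ _ _ (cut_rotate x J)).
  - by apply: allpairs_uniq; rewrite ?permutations_uniq ?iota_uniq// => -[? ?] [? ?] _ _ [-> ->].
  - move=> [t p] [t' p'] /allpairsP[[a b] /= [/permP[ua sa] hb [-> ->]]].
    move=> /allpairsP[[a' b'] /= [/permP[ua' sa'] hb' [-> ->]]] e.
    move: hb hb'; rewrite !mem_iota => hb hb'.
    by have [||||-> ->] := cut_rotate_inj _ _ _ _ _ _ gx ua _ _ _ _ e; rewrite ?sa ?sa'//; lia.
  - move=> [t p] /allpairsP[[a b] /= [pa hb [-> ->]]].
    have [ua sa] := permP _ pa; move: hb; rewrite mem_iota add0n => /= hb.
    have jt : (J <= size a)%N by rewrite sa.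
    have := cut_rotate_perm x J a b hb jt.
    have [us' [w [vs [r [_ et rw _ ->]]]]] := cut_rotate_spec x J a b hb jt.
    move=> /= hp; apply: (allpairs_f (fun l t' => (l, t'))).
      rewrite mem_iota; have := congr1 size et.
      by rewrite size_takel// flatten_cat /= !size_cat => eJ; apply/andP; split; lia.
    by rewrite mem_permutations (perm_trans hp)// -mem_permutations.
  - by move=> b; rewrite /G mulr_ge0// mulr_ge0// exprn_ge0.
  - move=> [t p] /allpairsP[[a b] /= [pa hb [-> ->]]].
    have [ua sa] := permP _ pa; move: hb; rewrite mem_iota add0n => /= hb.
    have jt : (J <= size a)%N by rewrite sa.
    have [us' [w [vs [r [g et rw _ ->]]]]] := cut_rotate_spec x J a b hb jt.
    have eJ := congr1 size et; rewrite size_takel// flatten_cat /= !size_cat in eJ.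
    rewrite /G /= et nb_faces_flatten// take_size_cat; last by rewrite flatten_cat size_cat; lia.
    rewrite nb_faces_flatten; last exact: faces_remove g.
    rewrite catA drop_size_cat; last by rewrite size_cat size_rot flatten_cat size_cat; lia.
    by rewrite !size_cat /= addnS exprS mulrA.
rewrite big_allpairs_dep /= -mulrA mulr_suml.
apply: (@le_trans _ _ (\sum_(l <- iota 1 J) z * (faces_mgf z (J - l) * B))).
  rewrite big_seq [leRHS]big_seq; apply: ler_sum => l; rewrite mem_iota => hl.
  rewrite /G /= -mulr_sumr ler_wpM2l//.
  (* The moved face occupies the first [l] entries after the shortened prefix, and the new weight
     skips them. *)
  have eB t : H (drop J t) = H (drop l (drop (J - l) t)).
    by rewrite drop_drop subnKC//; lia.
  rewrite /B; under eq_bigr do rewrite eB.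
  under [in leRHS]eq_bigr do rewrite eB.
  by apply: (IH (J - l)%N _ (fun v => H (drop l v))) => //; lia.
rewrite -mulr_sumr ler_wpM2l// -(big_mkord xpredT (fun i => faces_mgf z i * B)).
(* Reversal matches the lengths [J - l], for [l] from 1 to [J], with the indices from [J - 1] down
   to 0. *)
rewrite big_nat_rev /= add0n -(addn0 1%N) iotaDl big_map.
rewrite /index_iota subn0 le_eqVlt; apply/orP; left; apply/eqP.
by apply: eq_bigr => i _; rewrite add1n.
Qed.

Fixpoint piece_faces x (ms : seq nat) t : nat :=
  if ms is m :: ms' then (nb_faces x (take m t) + piece_faces x ms' (drop m t))%N else 0%N.

Lemma piece_faces_catl x ms u v : (sumn ms <= size u)%N ->
  piece_faces x ms (u ++ v) = piece_faces x ms u.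
Proof.
elim: ms u => [//|m ms IH] u /= h; have mu : (m <= size u)%N by lia.
have -> : drop m (u ++ v) = drop m u ++ v.
  by rewrite drop_cat; case: ltngtP mu => // -> _; rewrite subnn drop0 drop_size.
by rewrite takel_cat// IH// size_drop; lia.
Qed.

Lemma nb_faces_le_piece_faces x ms t : sumn ms = size t -> (nb_faces x t <= piece_faces x ms t)%N.
Proof.
elim: ms t => [|m ms IH] t /= h; first by rewrite (size0nil (esym h)).
rewrite -{1}(cat_take_drop m t); apply: leq_trans (nb_faces_cat _ _ _ _ _) _.
by rewrite leq_add2l IH// size_drop -h addKn.
Qed.

Lemma sum_rot_permutations (G : seq I -> R) s m :
  \sum_(t <- permutations s) G (rot m t) = \sum_(t <- permutations s) G t.
Proof.
rewrite -(big_map (rot m) xpredT G); apply: perm_big; apply: uniq_perm.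
- by rewrite map_inj_uniq ?permutations_uniq//; apply: rot_inj.
- exact: permutations_uniq.
move=> t; rewrite mem_permutations; apply/mapP/idP => [[u]|h].
  by rewrite mem_permutations => h ->; rewrite perm_rot.
exists (rotr m t); last by rewrite rotrK.
by rewrite mem_permutations perm_rotr.
Qed.

(** The first piece is peeled off by [sum_nb_faces_prefix], with the faces of the other pieces as
    weight of the tail. *)
Lemma sum_piece_faces_generic x (z : R) s ms :
  generic x -> 0 <= z -> uniq s -> (sumn ms <= size s)%N ->
  \sum_(t <- permutations s) z ^+ piece_faces x ms t <=
  (\prod_(m <- ms) faces_mgf z m) * (size s)`!%:R.
Proof.
move=> gx z0 us; elim: ms => [|m ms IH] /= h.
  rewrite big_nil mul1r; under eq_bigr do rewrite expr0.
  by rewrite big_const_seq count_predT size_permutations// iter_addr_0.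
under eq_bigr do rewrite exprD.
apply: le_trans (sum_nb_faces_prefix _ _ _ m (fun v => z ^+ piece_faces x ms v) gx z0 us _ _) _.
- by lia.
- by move=> v; apply: exprn_ge0.
rewrite big_cons -mulrA ler_wpM2l//.
  by apply: prodr_ge0 => i _; rewrite mulr_ge0 ?invr_ge0// addr_ge0.
apply: le_trans (IH _); last by lia.
(* Rotating by [m] moves the first piece behind the others, which only read the front. *)
rewrite -[leRHS](sum_rot_permutations _ _ m) big_seq [leRHS]big_seq; apply: ler_sum => t.
rewrite mem_permutations => /perm_size st.
by rewrite /rot piece_faces_catl// size_drop st; lia.
Qed.

End Recursion.

Arguments generic {R I}.
Arguments piece_faces {R I}.

(** * Breaking ties by a small polynomial perturbation *)

Section Perturbation.
Variable R : realFieldType.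

(** Just to the right of 0 the lowest nonzero coefficient governs: the induction either strips a
    factor ['X] or finds a constant term that dominates. *)
Lemma poly_near0 (q : {poly R}) : exists2 d, 0 < d &
  forall e, 0 < e < d -> (q != 0 -> q.[e] != 0) /\ (0 < q.[0] -> 0 < q.[e]).
Proof.
elim/poly_ind: q => [|p c [d d0 IH]].
  by exists 1 => // e _; rewrite eqxx !horner0 ltxx.
have [c0|c0] := eqVneq c 0.
  rewrite c0 addr0; exists d => // e he; rewrite !hornerM !hornerX mulr0 ltxx.
  split=> // h; apply: mulf_neq0; last by case/andP: he => e0 _; rewrite gt_eqF.
  by apply: (proj1 (IH e he)); apply: contraNneq h => ->; rewrite mul0r.
have [ub hub] := poly_itv_bound p 0 1.
have ub1 : 0 < `|ub| + 1 by rewrite ltr_wpDl.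
(* Here [ub] bounds [p] on the unit interval, so below this threshold [p.[e] * e] is smaller than
   [c] in absolute value. *)
exists (Num.min 1 (`|c| / (`|ub| + 1))).
  by rewrite lt_min ltr01 divr_gt0// normr_gt0.
move=> e /andP[e0]; rewrite lt_min ltr_pdivlMr// => /andP[e1 ec].
have hp : `|p.[e] * e| < `|c|.
  rewrite normrM (gtr0_norm e0) mulrC; apply: le_lt_trans ec.
  rewrite ler_wpM2l ?(ltW e0)//.
  have : `|p.[e]| <= ub by apply: hub; rewrite ltW//= ltW.
  have := ler_norm ub; lra.
rewrite !hornerE ?mulr0 ?add0r; split=> [_|cp].
  by apply: contraTneq hp => /eqP; rewrite addr_eq0 => /eqP ->; rewrite normrN ltxx.
by move: hp; rewrite (gtr0_norm cp) ltr_norml => /andP[]; lra.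
Qed.

Lemma polys_near0 (s : seq {poly R}) : exists2 e, 0 < e &
  forall q, q \in s -> (q != 0 -> q.[e] != 0) /\ (0 < q.[0] -> 0 < q.[e]).
Proof.
suff [d d0 h] : exists2 d, 0 < d & forall q, q \in s -> forall e, 0 < e < d ->
    (q != 0 -> q.[e] != 0) /\ (0 < q.[0] -> 0 < q.[e]).
  exists (d / 2); first by rewrite divr_gt0.
  by move=> q /h; apply; lra.
elim: s => [|q s [d d0 IH]]; first by exists 1.
have [d' d'0 h] := poly_near0 q.
exists (Num.min d d'); first by rewrite lt_min d0.
move=> r; rewrite inE => /orP[/eqP ->|rs] e; rewrite lt_min => /and3P[e0 e1 e2].
  by apply: h; rewrite e0.
by apply: IH; rewrite ?e0.
Qed.

Lemma mean_ltE (I : eqType) (x : I -> R) a b : a != [::] -> b != [::] ->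
  (mean x a < mean x b) =
  (0 < (size a)%:R * (\sum_(i <- b) x i) - (size b)%:R * \sum_(i <- a) x i).
Proof.
move=> /(size_gt0R R) a0 /(size_gt0R R) b0.
rewrite subr_gt0 /mean ltr_pdivrMr// mulrAC ltr_pdivlMr//.
by rewrite mulrC [X in _ < X]mulrC.
Qed.

Lemma mean_eqE (I : eqType) (x : I -> R) a b : a != [::] -> b != [::] ->
  (mean x a == mean x b) =
  ((size a)%:R * (\sum_(i <- b) x i) - (size b)%:R * \sum_(i <- a) x i == 0).
Proof.
move=> /(size_gt0R R) a0 /(size_gt0R R) b0.
by rewrite subr_eq0 /mean (eqr_div _ _ (lt0r_neq0 a0) (lt0r_neq0 b0)) eq_sym
           mulrC [X in _ == X]mulrC.
Qed.

(* Replacing [x i] by [x i + e ^+ i.+1] for small [e] breaks all ties and keeps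
   every strict inequality between means. *)
Lemma generic_perturbation (n : nat) (x : 'I_n -> R) : exists2 y : 'I_n -> R, generic y &
  forall a b, a != [::] -> b != [::] -> uniq a -> uniq b ->
    mean x a < mean x b -> mean y a < mean y b.
Proof.
pose yp (i : 'I_n) : {poly R} := (x i)%:P + 'X^(i.+1).
pose Q (a b : seq 'I_n) := (size a)%:R *: (\sum_(i <- b) yp i)
                          - (size b)%:R *: (\sum_(i <- a) yp i).
(* For duplicate-free [a] and [b], [Q a b] depends only on their sets of indices, so one [e] has to
   serve finitely many polynomials. *)
have [e e0 he] := polys_near0 [seq Q (enum A) (enum B) |
  A : {set 'I_n} <- enum {set 'I_n}, B : {set 'I_n} <- enum {set 'I_n}].
have QE a b : uniq a -> uniq b -> (Q a b != 0 -> (Q a b).[e] != 0) /\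
    (0 < (Q a b).[0] -> 0 < (Q a b).[e]).
  move=> ua ub; have pe (c : seq 'I_n) : uniq c -> perm_eq c (enum [set i in c]).
    by move=> uc; apply: uniq_perm; rewrite ?enum_uniq// => i; rewrite mem_enum inE.
  have -> : Q a b = Q (enum [set i in a]) (enum [set i in b]).
    by rewrite /Q (perm_size (pe _ ua)) (perm_size (pe _ ub)) (perm_big _ (pe _ ua))
               (perm_big _ (pe _ ub)).
  by apply: he; apply: (allpairs_f (fun A B : {set 'I_n} => Q (enum A) (enum B))); rewrite mem_enum.
pose y i := x i + e ^+ i.+1.
have Qe a b : (Q a b).[e] =
    (size a)%:R * (\sum_(i <- b) y i) - (size b)%:R * \sum_(i <- a) y i.
  by rewrite !hornerE !horner_sum; congr (_ * _ - _ * _); apply: eq_bigr => i _; rewrite !hornerE.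
have Q0 a b : (Q a b).[0] =
    (size a)%:R * (\sum_(i <- b) x i) - (size b)%:R * \sum_(i <- a) x i.
  by rewrite !hornerE !horner_sum; congr (_ * _ - _ * _); apply: eq_bigr => i _;
     rewrite !hornerE expr0n addr0.
exists y => [a b a0 b0|a b a0 b0 ua ub]; last first.
  by rewrite !mean_ltE// -Q0 -Qe; apply: (proj2 (QE _ _ ua ub)).
rewrite cat_uniq => /and3P[ua /hasPn ab ub].
rewrite mean_eqE// -Qe; apply: (proj1 (QE _ _ ua ub)).
(* At the power belonging to the first index of [b], the coefficient of [Q a b] is [size a], as this
   index occurs once in [b] and never in [a]. *)
case: b b0 ab ub => [//|i b] _ ab ub; apply/eqP => /(congr1 (fun q : {poly R} => q`_i.+1)).
rewrite coef0 coefB !coefZ !coef_sum.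
have yc j : (yp j)`_i.+1 = (j == i)%:R.
  by rewrite coefD coefC coefXn /= add0r eqSS eq_sym.
rewrite (eq_bigr (fun j => (j == i)%:R)); last by move=> j _; rewrite yc.
rewrite [X in _ - _ * X](eq_bigr (fun j => (j == i)%:R)); last by move=> j _; rewrite yc.
rewrite big_cons eqxx [X in _ * (_ + X)]big_seq big1 => [|j jb]; last first.
  by case: eqP => // ji; move: ub; rewrite /= -ji jb.
rewrite [X in _ - _ * X]big_seq big1 => [|j ja]; last first.
  by case: eqP => // ji; have := ab i (mem_head _ _); rewrite -ji ja.
rewrite addr0 mulr1 mulr0 subr0 => /eqP; rewrite gt_eqF//.
exact: size_gt0R.
Qed.

Lemma piece_faces_homo (I : eqType) (x y : I -> R) ms t :
  (forall a b, a != [::] -> b != [::] -> uniq a -> uniq b ->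
    mean x a < mean x b -> mean y a < mean y b) ->
  uniq t -> (piece_faces x ms t <= piece_faces y ms t)%N.
Proof.
move=> h; elim: ms t => [//|m ms IH] t ut /=.
rewrite leq_add ?IH ?drop_uniq//; apply: nb_faces_homo; rewrite ?take_uniq// => a b a0 b0 _ _.
exact: h.
Qed.

(** Perturbing can only add faces, and [1 <= z] makes the powers grow with them. *)
Lemma sum_piece_faces (n : nat) (x : 'I_n -> R) (z : R) (ms : seq nat) :
  1 <= z -> (sumn ms <= n)%N ->
  \sum_(t <- permutations (enum 'I_n)) z ^+ piece_faces x ms t <=
  (\prod_(m <- ms) faces_mgf R z m) * n`!%:R.
Proof.
move=> z1 hms; have [y gy xy] := generic_perturbation n x.
apply: (@le_trans _ _ (\sum_(t <- permutations (enum 'I_n)) z ^+ piece_faces y ms t)).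
  rewrite big_seq [leRHS]big_seq; apply: ler_sum => t.
  rewrite mem_permutations => /perm_uniq; rewrite enum_uniq => ut.
  by rewrite ler_weXn2l// piece_faces_homo.
have := sum_piece_faces_generic R _ y z (enum 'I_n) ms gy _ (enum_uniq _).
by rewrite size_enum_ord; apply => //; lra.
Qed.

End Perturbation.

Lemma piece_faces_map (R : realFieldType) (I J : eqType) (x : I -> R) (f : J -> I) ms (s : seq J) :
  piece_faces x ms (map f s) = piece_faces (x \o f) ms s.
Proof.
by elim: ms s => [//|m ms IH] s /=; rewrite -map_take -map_drop nb_faces_map IH.
Qed.

(** * The projection and its blocks *)

Section Projection.
Variable R : realType.

(** Summation by parts: [c] is the partial sum so far and [h] the last weight. As [c] is
    nonnegative, replacing [h] by the next, larger weight only increases the left side. *)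
Lemma abel_le (I : eqType) (s : seq I) (f z : I -> R) (c h : R) :
  (forall k, 0 <= c + \sum_(i <- take k s) f i) -> path <=%R h (map z s) ->
  c * h + \sum_(i <- s) f i * z i <= (c + \sum_(i <- s) f i) * last h (map z s).
Proof.
elim: s c h => [|i s IH] c h /= hc; first by rewrite !big_nil !addr0.
move=> /andP[hz hp]; rewrite !big_cons !addrA.
have c0 := hc 0%N; rewrite take0 big_nil addr0 in c0.
apply: le_trans (IH (c + f i) (z i) _ hp).
  by rewrite lerD2r mulrDl lerD2r ler_wpM2l.
by move=> k; have := hc k.+1; rewrite /= big_cons addrA.
Qed.

Lemma mem_block_eq (I : eqType) (ws : seq (seq I)) u w i : uniq (flatten ws) ->
  u \in ws -> w \in ws -> i \in u -> i \in w -> u = w.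
Proof.
elim: ws => [//|a ws IH] /=; rewrite cat_uniq => /and3P[_ /hasPn h uf].
rewrite !inE => /orP[/eqP -> | uw] /orP[/eqP -> | ww] //= iu iw.
- by have /h : i \in flatten ws; [apply/flattenP; exists w|rewrite /= iu].
- by have /h : i \in flatten ws; [apply/flattenP; exists u|rewrite /= iw].
- exact: IH.
Qed.

Lemma pairwise_in (I : eqType) (r : rel I) (s : seq I) :
  {in s &, forall i j, r i j} -> pairwise r s.
Proof.
elim: s => [//|i s IH] h /=; apply/andP; split.
  by apply/allP => j js; apply: h; rewrite inE ?eqxx ?js ?orbT.
by apply: IH => j k js ks; apply: h; rewrite inE ?js ?ks orbT.
Qed.

Variables (n : nat) (y : 'I_n -> R).
Let ws := pava y (enum 'I_n).

Let fws : flatten ws = enum 'I_n.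
Proof. exact: pava_flatten. Qed.

Let gws : faces y ws.
Proof. exact: pava_faces. Qed.

(** The candidate for the projection. Every index lies in a block, so the default [[::]] is never
    reached. *)
Definition block_mean (i : 'I_n) : R := mean y (nth [::] ws (find (fun w => i \in w) ws)).

Lemma block_meanE w i : w \in ws -> i \in w -> block_mean i = mean y w.
Proof.
move=> ww iw; have hi : has (fun w => i \in w) ws by apply/hasP; exists w.
congr (mean y); apply: (@mem_block_eq _ ws _ _ i) => //; first by rewrite fws enum_uniq.
  by rewrite mem_nth// -has_find.
exact: (nth_find [::] hi).
Qed.

Lemma block_mean_exists i : exists2 w, w \in ws & i \in w.
Proof. by apply/flattenP; rewrite fws mem_enum. Qed.

Lemma sum_blocks (F : 'I_n -> R) :
  \sum_(i < n) F i = \sum_(w <- ws) \sum_(i <- w) F i.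
Proof. by rewrite -big_flatten fws big_enum. Qed.

Lemma block_mean_monotone : monotone_cone block_mean.
Proof.
have hw : pairwise (fun i j => block_mean i <= block_mean j) (flatten ws).
  have : pairwise (fun u v => mean y u < mean y v) ws.
    by rewrite -sorted_pairwise; [apply: (proj2 gws)|apply: mean_lt_trans].
  have : {subset ws <= ws} by [].
  (* Only the traversed list is generalized; [block_mean] and the membership bound still refer to
     all of [ws]. *)
  elim: {1 3 4}ws => [//|w vs IH] sub /= /andP[hw hvs].
  rewrite pairwise_cat IH ?andbT//; last by move=> v vv; apply: sub; rewrite inE vv orbT.
  have ww : w \in ws by apply: sub; rewrite inE eqxx.
  apply/andP; split.
    apply/allrelP => i j iw /flattenP[v vv jv].
    rewrite (block_meanE _ _ ww iw) (@block_meanE v)//; last by apply: sub; rewrite inE vv orbT.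
    by apply: ltW; apply: (allP hw).
  apply: pairwise_in => i j iw jw.
  by rewrite !(block_meanE w).
move=> i j; rewrite leq_eqVlt => /orP[/eqP/val_inj -> //|ij].
move: hw; rewrite fws => /(pairwiseP i) /(_ i j).
by rewrite !inE size_enum_ord !ltn_ord !nth_ord_enum; apply.
Qed.

Lemma nb_distinct_block_mean : nb_distinct block_mean = size ws.
Proof.
rewrite /nb_distinct -(size_map (mean y) ws); apply: perm_size; apply: uniq_perm.
- exact: undup_uniq.
- apply: (@sorted_uniq _ <%R); [exact: lt_trans|exact: ltxx|].
  by rewrite sorted_map; apply: (proj2 gws).
move=> c; rewrite mem_undup; apply/mapP/mapP => [[i _ ->]|[w ww ->]].
  by have [w ww iw] := block_mean_exists i; exists w => //; apply: block_meanE.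
have [w0 _] := proj1 gws _ ww; case: w w0 ww => [//|i w] _ ww.
by exists i; [rewrite mem_enum|rewrite (block_meanE (i :: w))// inE eqxx].
Qed.

(** Together with [sum_block_le0], the variational characterization of projection onto a convex
    cone: the residual is orthogonal to the projection and lies in the polar cone. *)
Lemma sum_block_orth : \sum_(i < n) (y i - block_mean i) * block_mean i = 0.
Proof.
rewrite sum_blocks big_seq big1// => w ww.
rewrite big_seq (eq_bigr (fun i => (y i - mean y w) * mean y w)) => [|i iw]; last first.
  by rewrite (block_meanE w).
by rewrite -big_seq -mulr_suml -/(dev _ _ _) dev_mean mul0r.
Qed.

(** On each block the residuals have nonnegative partial sums, by irreducibility, and total zero;
    summation by parts against the nondecreasing [z] gives the sign. *)
Lemma sum_block_le0 z : monotone_cone z -> \sum_(i < n) (y i - block_mean i) * z i <= 0.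
Proof.
move=> mz; rewrite sum_blocks big_seq; apply: sumr_le0 => w ww.
rewrite big_seq (eq_bigr (fun i => (y i - mean y w) * z i)) => [|i iw]; last first.
  by rewrite (block_meanE w).
rewrite -big_seq.
have zw : sorted (fun i j => z i <= z j) w.
  apply: (@subseq_sorted _ _ _ w (enum 'I_n)).
  - by move=> i j k; apply: le_trans.
  - rewrite -fws; case/splitPr: ww => us vs; rewrite flatten_cat /=.
    exact: subseq_trans (prefix_subseq _ _) (suffix_subseq _ _).
  have : sorted leq (map val (enum 'I_n)) by rewrite val_enum_ord iota_sorted.
  by rewrite sorted_map; apply: sub_sorted => i j; apply: mz.
have irw := proj1 gws _ ww; have [w0 _] := irw.
case: w w0 irw zw {ww} => [//|i w] w0 irw zw.
have := @abel_le _ (i :: w) (fun j => y j - mean y (i :: w)) z 0 (z i).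
rewrite mul0r add0r -/(dev _ _ _) dev_mean addr0 mul0r; apply.
  move=> k; rewrite add0r -/(dev _ _ _).
  have [->|t0] := eqVneq (take k (i :: w)) [::]; first by rewrite /dev big_nil.
  by rewrite -le_mean// -{1}(cat_take_drop k (i :: w)) irreducible_prefix// cat_take_drop.
by rewrite /= lexx path_map.
Qed.

(** This Pythagorean inequality yields both minimality and uniqueness of the projection. *)
Lemma block_mean_proj z : monotone_cone z ->
  sqdist y block_mean + sqdist block_mean z <= sqdist y z.
Proof.
move=> mz; rewrite /sqdist -big_split /=.
have := sum_block_le0 z mz; have := sum_block_orth.
have -> : \sum_(i < n) (y i - z i) ^+ 2 =
  \sum_(i < n) ((y i - block_mean i) ^+ 2 + (block_mean i - z i) ^+ 2) +
  2 * \sum_(i < n) (y i - block_mean i) * block_mean i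
  - 2 * \sum_(i < n) (y i - block_mean i) * z i.
  rewrite !mulr_sumr -addrA -sumrB -big_split /=.
  by apply: eq_bigr => i _ /=; ring.
by lra.
Qed.

Lemma mono_projE : mono_proj y = block_mean.
Proof.
have hp : is_mono_proj y block_mean.
  split=> [|z mz]; first exact: block_mean_monotone.
  apply: le_trans (block_mean_proj z mz); rewrite lerDl.
  by apply: sumr_ge0 => i _; rewrite sqr_ge0.
have [mz hz] : is_mono_proj y (mono_proj y).
  by rewrite /mono_proj; case: xgetP => [x -> //|/(_ block_mean)].
apply/funext => i; apply/eqP; rewrite eq_sym -subr_eq0 -sqrf_eq0.
have h1 := block_mean_proj _ mz; have h2 := hz _ block_mean_monotone.
have h3 : sqdist block_mean (mono_proj y) <= 0 by lra.
have : sqdist block_mean (mono_proj y) == 0.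
  by rewrite eq_le h3 /=; apply: sumr_ge0 => j _; rewrite sqr_ge0.
rewrite /sqdist psumr_eq0 => [/allP/(_ i (mem_index_enum _))//|j _].
by rewrite sqr_ge0.
Qed.

Lemma nb_distinct_mono_proj : nb_distinct (mono_proj y) = nb_faces y (enum 'I_n).
Proof.
by rewrite mono_projE nb_distinct_block_mean -[in RHS]fws nb_faces_flatten.
Qed.

End Projection.

(** * Logarithmic bounds and the constant pieces of [mu] *)

Section Bounds.
Variable R : realType.

Lemma ln_le_subr1 (u : R) : 0 < u -> ln u <= u - 1.
Proof.
move=> u0; have := expR_ge1Dx (ln u); rewrite lnK ?posrE//; lra.
Qed.

(** Each new factor is [1 + (z - 1) / M.+1], at most the exponential of [(z - 1) / M.+1], and
    [1 / M.+1] is at most the increment of [ln]. *)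
Lemma faces_mgf_le (z : R) m : 1 <= z -> (0 < m)%N ->
  faces_mgf R z m <= expR ((z - 1) * (1 + ln m%:R)).
Proof.
move=> z1; have z0 : 0 <= z by lra.
have z10 : 0 <= z - 1 by lra.
elim: m => [//|[|m] IH] _.
  rewrite /faces_mgf big_ord1 ln1 addr0 mulr1 add0r divr1.
  by have := expR_ge1Dx (z - 1); lra.
rewrite /faces_mgf big_ord_recr /= -/(faces_mgf R z m.+1).
set M := m.+1 in IH *; have M0 : 0 < M%:R :> R by rewrite ltr0n.
have M1 : 0 < M.+1%:R :> R by rewrite ltr0n.
have eM : M.+1%:R = M%:R + 1 :> R by rewrite natr1.
have hf : (M%:R + z) / M.+1%:R <= expR ((z - 1) / M.+1%:R).
  apply: le_trans (expR_ge1Dx _); rewrite le_eqVlt; apply/orP; left; apply/eqP.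
  by rewrite eM; field; rewrite -eM gt_eqF.
have hl : ln M%:R + M.+1%:R^-1 <= ln M.+1%:R :> R.
  have := ln_le_subr1 (M%:R / M.+1%:R) (divr_gt0 M0 M1).
  rewrite ln_div ?posrE//.
  have -> : M%:R / M.+1%:R - 1 = - M.+1%:R^-1 :> R.
    by rewrite eM; field; rewrite -eM gt_eqF.
  by move: (ln M%:R) (ln M.+1%:R) (M.+1%:R^-1) => a b c; lra.
apply: (@le_trans _ _ (expR ((z - 1) * (1 + ln M%:R)) * expR ((z - 1) / M.+1%:R))).
  apply: ler_pM => //; last exact: IH.
    by apply: prodr_ge0 => i _; rewrite divr_ge0// addr_ge0.
  by rewrite divr_ge0// addr_ge0.
by rewrite -expRD ler_expR -mulrDr ler_wpM2l// -addrA lerD2l.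
Qed.

Lemma sum_ln_le (ms : seq nat) : all (fun m => 0 < m)%N ms -> ms != [::] ->
  \sum_(m <- ms) (1 + ln m%:R) <=
  (size ms)%:R * ln (expR 1 * (sumn ms)%:R / (size ms)%:R) :> R.
Proof.
move=> /allP h ms0.
have k0 : 0 < (size ms)%:R :> R by rewrite ltr0n lt0n size_eq0.
have n0 : 0 < (sumn ms)%:R :> R.
  case: ms h ms0 {k0} => [//|m ms] h _ /=; rewrite ltr0n addn_gt0.
  by rewrite (h m (mem_head _ _)).
set k := (size ms)%:R in k0 *; set N := (sumn ms)%:R in n0 *.
have -> : ln (expR 1 * N / k) = 1 + ln (N / k).
  by rewrite -mulrA lnM ?posrE ?expR_gt0 ?divr_gt0// expRK.
(* The tangent line of the concave [ln] at the average length [N / k]; its linear terms sum to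
   zero. *)
apply: (@le_trans _ _ (\sum_(m <- ms) (1 + ln (N / k) + (m%:R * (k / N) - 1)))).
  rewrite big_seq [leRHS]big_seq; apply: ler_sum => m /h m0.
  have m0' : 0 < m%:R :> R by rewrite ltr0n.
  have := ln_le_subr1 (m%:R / (N / k)) (divr_gt0 m0' (divr_gt0 n0 k0)).
  have -> : ln (m%:R / (N / k)) = ln m%:R - ln (N / k).
    by apply: ln_div; rewrite posrE// divr_gt0.
  rewrite invf_div.
  by move: (ln m%:R) (ln (N / k)) (m%:R * (k / N)) => a b c; lra.
rewrite big_split /= sumrB -mulr_suml.
have -> : \sum_(m <- ms) m%:R = N by rewrite /N sumnE natr_sum.
rewrite !big_const_seq !count_predT !iter_addr_0 -[(1 + _) *+ _]mulr_natl -/k.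
by rewrite (_ : N * (k / N) = k) ?subrr ?addr0//; field; rewrite gt_eqF.
Qed.

Lemma nb_faces_shift (I : eqType) (x y : I -> R) (c : R) t : uniq t ->
  (forall i, i \in t -> y i = x i + c) -> nb_faces y t = nb_faces x t.
Proof.
have meanD (u v : I -> R) e a : a != [::] -> (forall i, i \in a -> v i = u i + e) ->
    mean v a = mean u a + e.
  move=> /(size_gt0R R) a0 h; rewrite /mean big_seq (eq_bigr (fun i => u i + e)) => [|i /h //].
  rewrite -big_seq big_split /= big_const_seq count_predT iter_addr_0 -[e *+ _]mulr_natl.
  by field; rewrite gt_eqF.
move=> ut h; apply/eqP; rewrite eqn_leq; apply/andP; split; apply: nb_faces_homo => //.
  move=> a b a0 b0 sa sb _ _.
  rewrite (meanD x y c a)// ?(meanD x y c b)// ?ltrD2r// => i ?; apply: h.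
    exact: sb.
  exact: sa.
move=> a b a0 b0 sa sb _ _; rewrite (meanD x y c a)// ?(meanD x y c b)// ?ltrD2r// => i ?; apply: h.
  exact: sb.
exact: sa.
Qed.

Fixpoint runs (I : eqType) (mu : I -> R) (ms : seq nat) (s : seq I) : bool :=
  if ms is m :: ms' then
    constant (map mu (take m s)) && runs I mu ms' (drop m s)
  else s == [::].

(** Built from the right, a piece starts whenever the value changes; by monotonicity the new value
    is below all later ones, so each piece adds one distinct value. *)
Lemma runs_exist (I : eqType) (mu : I -> R) (s : seq I) :
  sorted (fun i j => mu i <= mu j) s -> exists ms, [/\ runs I mu ms s,
    size ms = size (undup (map mu s)), sumn ms = size s & all (fun m => 0 < m)%N ms].
Proof.
elim: s => [|i s IH] hs; first by exists [::].
have [ms [hr hsz hsum h0]] := IH (path_sorted hs).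
case: s => [|j s] in hs IH hr hsz hsum *; first by exists [:: 1%N].
case: ms => [//|m ms] in hr hsz hsum h0 *.
move: (h0) => /= /andP[m0 _].
move: hs => /= /andP[ij hs].
have hall k : k \in j :: s -> mu j <= mu k.
  rewrite inE => /orP[/eqP -> //|].
  have tr : transitive (fun i j => mu i <= mu j) by move=> ? ? ?; apply: le_trans.
  by apply/allP: k; apply: order_path_min hs.
have [e|ne] := eqVneq (mu i) (mu j).
  exists (m.+1 :: ms); split => //.
  - move: hr => /= /andP[h1 ->]; rewrite andbT.
    case: m m0 h1 {hsum hsz h0} => [//|m] _ /=; rewrite e eqxx /=.
    by [].
  - by rewrite -[size (m.+1 :: ms)]/(size (m :: ms)) hsz /= e inE eqxx.
  - by move: hsum => /=; lia.
  - by move: h0 => /= /andP[].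
exists (1%N :: m :: ms); split => //.
- have hni : mu i \notin mu j :: map mu s.
    rewrite -[_ :: _]/(map mu (j :: s)); apply/negP => /mapP[k /hall jk ik].
    by move: ne; rewrite eq_le ij /= ik jk.
  by move: hsz => /= ->; rewrite (negbTE hni).
- by move: hsum => /=; lia.
Qed.

(** On each piece [mu] is a constant shift, which preserves all comparisons of means. *)
Lemma piece_faces_runs (I : eqType) (mu x : I -> R) ms s : uniq s -> runs I mu ms s ->
  piece_faces (fun i => mu i + x i) ms s = piece_faces x ms s.
Proof.
elim: ms s => [//|m ms IH] s us /= /andP[hc hr]; rewrite IH ?drop_uniq//; congr addn.
case e : (take m s) hc => [//|i t] /= /all_pred1P hc.
apply: (@nb_faces_shift _ _ _ (mu i)); first by rewrite -e take_uniq.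
move=> j; rewrite inE => /orP[/eqP -> |jt]; rewrite addrC//; congr (_ + _).
have : mu j \in map mu t by apply: map_f.
by rewrite hc => /nseqP[].
Qed.

Lemma sum_piece_faces_exp (n : nat) (x : 'I_n -> R) (z : R) (ms : seq nat) :
  1 <= z -> sumn ms = n -> all (fun m => 0 < m)%N ms -> (0 < n)%N ->
  \sum_(t <- permutations (enum 'I_n)) z ^+ piece_faces x ms t <=
  expR ((z - 1) * ((size ms)%:R * ln (expR 1 * n%:R / (size ms)%:R))) * n`!%:R.
Proof.
move=> z1 hn h0 n0; apply: le_trans (sum_piece_faces R n x z ms z1 _) _; first by rewrite hn.
rewrite ler_wpM2r//.
apply: (@le_trans _ _ (\prod_(m <- ms) expR ((z - 1) * (1 + ln m%:R)))).
  rewrite big_seq [leRHS]big_seq; apply: ler_prod => m mms; apply/andP; split.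
    by apply: prodr_ge0 => i _; rewrite divr_ge0// addr_ge0//; lra.
  by apply: faces_mgf_le => //; apply: (allP h0).
rewrite -expR_sum ler_expR -mulr_sumr ler_wpM2l//; first by lra.
rewrite -hn sum_ln_le//; apply: contraTneq n0 => e; by rewrite -hn e.
Qed.

End Bounds.

(** * Measurability and exchangeability *)

Section Measurability.
Variables (R : realType) (d : measure_display) (U : measurableType d).

Lemma measurable_count (A : Type) (p : U -> A -> bool) (s : seq A) :
  (forall a, measurable_fun setT (p ^~ a)) -> measurable_fun setT (fun u => count (p u) s).
Proof.
move=> mp; elim: s => [|a s IH] /=; first exact: measurable_cst.
apply: measurable_fun_addn => //.
exact: (@measurableT_comp _ _ _ _ _ _ nat_of_bool _ (p ^~ a)).
Qed.

Lemma measurable_all (A : Type) (p : U -> A -> bool) (s : seq A) :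
  (forall a, measurable_fun setT (p ^~ a)) -> measurable_fun setT (fun u => all (p u) s).
Proof.
move=> mp; elim: s => [|a s IH] /=; first exact: measurable_cst.
exact: measurable_and.
Qed.

Variables (I : eqType) (x : U -> I -> R).
Hypothesis mx : forall i, measurable_fun setT (x ^~ i).

Lemma measurable_nb_faces s : measurable_fun setT (fun u => nb_faces (x u) s).
Proof.
have mmean t : measurable_fun setT (fun u => mean (x u) t).
  rewrite /mean; apply: measurable_funM; last exact: measurable_cst.
  exact: measurable_sum.
apply: measurable_count => i; rewrite /separated; apply: measurable_all => a.
by apply: measurable_all => b; apply: measurable_fun_ltr.
Qed.

Lemma measurable_piece_faces ms s : measurable_fun setT (fun u => piece_faces (x u) ms s).
Proof.
elim: ms s => [|m ms IH] s /=; first exact: measurable_cst.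
by apply: measurable_fun_addn; [exact: measurable_nb_faces|exact: IH].
Qed.

Lemma measurable_natfun (f : nat -> R) (K : U -> nat) :
  measurable_fun setT K -> measurable_fun setT (fun u => f (K u)).
Proof. by move=> mK; apply: (@measurableT_comp _ _ _ _ _ _ f). Qed.

End Measurability.

Section Exchangeability.
Variables (R : realType) (d : measure_display) (T : measurableType d).
Variables (P : probability T R) (n : nat) (nu : set R -> \bar R) (xi : 'I_n -> {RV P >-> R}).
Hypothesis xi_law : forall (i : 'I_n) (A : set R), measurable A ->
  P (xi i @^-1` A) = nu A.
Hypothesis xi_indep : forall B : 'I_n -> set R, (forall i, measurable (B i)) ->
  P [set w | forall i, B i (xi i w)] = (\prod_(i < n) P (xi i @^-1` B i))%E.

Let X (p : {perm 'I_n}) (w : T) : n.-tuple R := [tuple xi (p i) w | i < n].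

Let mX p : measurable_fun setT (X p).
Proof.
apply/measurable_fun_tnthP => i.
rewrite (_ : _ \o _ = xi (p i)); first exact: measurable_funPT.
by apply/funext => w /=; rewrite tnth_mktuple.
Qed.

HB.instance Definition _ p := isMeasurableFun.Build _ _ _ _ (X p) (mX p).

(** The measurable rectangles: stable under intersection, generating the sigma-algebra on tuples,
    and with the same probability for every ordering of the noise. *)
Let rect : set (set (n.-tuple R)) := [set A | exists2 B : 'I_n -> set R,
  (forall i, measurable (B i)) & A = [set t | forall i, B i (tnth t i)]].

Let rectT : rect setT.
Proof.
by exists (fun=> setT) => //; apply/seteqP; split.
Qed.

Let P_rect p (B : 'I_n -> set R) : (forall i, measurable (B i)) ->
  P (X p @^-1` [set t | forall i, B i (tnth t i)]) =
  (\prod_(i < n) nu (B i))%E.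
Proof.
move=> mB; transitivity (P [set w | forall j, B (p^-1 j)%g (xi j w)]).
  congr (P _); apply/seteqP; split => w /= h i.
    by have := h (p^-1 i)%g; rewrite tnth_mktuple permKV.
  by have := h (p i); rewrite permK tnth_mktuple.
rewrite (xi_indep (fun j => B (p^-1 j)%g))// (reindex_perm p) /=; apply: eq_bigr => i _.
by rewrite permK xi_law.
Qed.

Lemma law_perm p q (A : set (n.-tuple R)) : measurable A ->
  P (X p @^-1` A) = P (X q @^-1` A).
Proof.
move=> mA.
have rI : setI_closed rect.
  move=> _ _ [B mB ->] [C mC ->]; exists (fun i => B i `&` C i).
    by move=> i; apply: measurableI.
  apply/seteqP; split=> t /= => [[h1 h2] i|h]; first by split.
  by split=> i; have [] := h i.
have rm : rect `<=` measurable.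
  move=> _ [B mB ->].
  rewrite (_ : [set _ | _] = \big[setI/setT]_(i < n) ((@tnth n R)^~ i @^-1` B i)).
    apply: bigsetI_measurable => i _; rewrite -[X in measurable X]setTI.
    exact: measurable_tnth.
  apply/seteqP; split=> t /=; rewrite -bigcap_seq /=; first by move=> h i _.
  by move=> h i; apply: h => /=; rewrite mem_index_enum.
have := @g_sigma_algebra_measure_unique _ R _ rect rm (fun=> setT) (fun=> rectT) _
  (pushforward P (X p)) (pushforward P (X q)) rI _ _ A.
apply.
- by rewrite bigcup_const.
- move=> _ [B mB ->]; exact: etrans (P_rect p B mB) (esym (P_rect q B mB)).
- by move=> k; rewrite -[X in (X < _)%E]/(P (X p @^-1` setT)) preimage_setT probability_setT ltry.
(* The generators constrain a single coordinate, hence are rectangles whose other sides are full. *)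
move: A mA; apply: sub_smallest2r; first exact: smallest_sigma_algebra.
move=> A; rewrite -bigcup_seq => -[i _ [Y mY <-]].
exists (fun j => if j == i then Y else setT) => [j|]; first by case: ifP.
rewrite setTI; apply/seteqP; split=> t /= h; first by move=> j; case: eqP => // ->.
by have := h i; rewrite eqxx.
Qed.

Lemma integral_perm p q (f : n.-tuple R -> R) : measurable_fun setT f ->
  (forall t, 0 <= f t) ->
  (\int[P]_w (f (X p w))%:E = \int[P]_w (f (X q w))%:E)%E.
Proof.
move=> mf f0.
have h r : (\int[pushforward P (X r)]_t (f t)%:E = \int[P]_w (f (X r w))%:E)%E.
  rewrite (@ge0_integral_pushforward _ _ _ _ R (X r) (mX r) P setT (EFin \o f))//.
  - exact/measurable_EFinP.
  - by move=> t _; rewrite /= lee_fin.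
rewrite -!h; apply: eq_measure_integral => A mA _.
exact: law_perm.
Qed.

(** All orderings have the same integral, so [n!] times it is the integral of the sum over
    orderings, which is bounded for each fixed value of the noise. *)
Lemma integral_piece_faces_le (z : R) (ms : seq nat) :
  1 <= z -> sumn ms = n -> all (fun m => 0 < m)%N ms -> (0 < n)%N ->
  (\int[P]_w (z ^+ piece_faces (fun i => xi i w) ms (enum 'I_n))%:E <=
   (expR ((z - 1) * ((size ms)%:R * ln (expR 1 * n%:R / (size ms)%:R))))%:E)%E.
Proof.
move=> z1 hn h0 n0; set C := expR _.
have z0 : 0 <= z by apply: le_trans z1.
pose F t w := z ^+ piece_faces (fun i => xi i w) ms t.
have mF t : measurable_fun setT (F t).
  apply: (measurable_natfun _ _ _ (fun k => z ^+ k)).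
  by apply: measurable_piece_faces => i; exact: measurable_funPT.
have F0 t w : 0 <= F t w by apply: exprn_ge0.
have e t : t \in permutations (enum 'I_n) ->
    (\int[P]_w (F t w)%:E = \int[P]_w (F (enum 'I_n) w)%:E)%E.
  rewrite mem_permutations -[enum 'I_n]/(val (ord_tuple n)) => /tuple_permP[p ->].
  have hF (r : {perm 'I_n}) w : F [seq r i | i <- enum 'I_n] w =
      (fun u : n.-tuple R => z ^+ piece_faces (tnth u) ms (enum 'I_n)) (X r w).
    rewrite /F piece_faces_map; congr (_ ^+ piece_faces _ _ _).
    by apply/funext => i; rewrite /= tnth_mktuple.
  transitivity (\int[P]_w (F [seq p i | i <- enum 'I_n] w)%:E)%E.
    apply: eq_integral => w _; congr (F _ w)%:E => /=.
    by apply: eq_map => i; rewrite tnth_ord_tuple.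
  transitivity (\int[P]_w (F [seq (1%g : {perm 'I_n}) i | i <- enum 'I_n] w)%:E)%E; last first.
    apply: eq_integral => w _; congr (F _ w)%:E => /=.
    by rewrite -[RHS]map_id; apply: eq_map => i; rewrite perm1.
  under eq_integral do rewrite hF; under [RHS]eq_integral do rewrite hF.
  apply: (integral_perm p 1%g (fun u : n.-tuple R => z ^+ piece_faces (tnth u) ms (enum 'I_n)));
    last by move=> u; apply: exprn_ge0.
  apply: (measurable_natfun _ _ _ (fun k => z ^+ k)).
  by apply: (measurable_piece_faces _ _ _ _ (fun u : n.-tuple R => tnth u)) => i;
    apply: measurable_tnth.
have f0 : 0 < n`!%:R :> R by rewrite ltr0n fact_gt0.
rewrite -(@lee_pmul2l _ (n`!%:R)%:E) ?lte_fin//.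
have -> : ((n`!%:R)%:E * \int[P]_w (F (enum 'I_n) w)%:E =
    \int[P]_w \sum_(t <- permutations (enum 'I_n)) (F t w)%:E)%E.
  rewrite ge0_integral_sum//; last 2 first.
  - by move=> t; exact/measurable_EFinP.
  - by move=> t w _; rewrite lee_fin.
  rewrite big_seq (eq_bigr (fun=> \int[P]_w (F (enum 'I_n) w)%:E)%E)//.
  rewrite -big_seq big_const_seq count_predT size_permutations ?enum_uniq//.
  by rewrite size_enum_ord mule_natl; apply/esym/iter_addr_0.
apply: (@le_trans _ _ (\int[P]_w (cst (C * n`!%:R)%:E w))%E).
  apply: ge0_le_integral => //.
  - by move=> w _; apply: sume_ge0 => t _; rewrite lee_fin.
  - by apply: emeasurable_sum => t; exact/measurable_EFinP.
  - by move=> w _ /=; rewrite sumEFin lee_fin; apply: sum_piece_faces_exp.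
rewrite integral_cst// [X in (_ * X <= _)%E](_ : _ = 1%E); last exact: probability_setT.
by rewrite mule1 EFinM muleC.
Qed.

End Exchangeability.

(** * Deviation bound and mean *)

Lemma le_of_expR_bound (R : realType) (a C : R) : 0 < C ->
  (forall e, 0 < e -> 1 + e * a <= expR (e * C)) -> a <= C.
Proof.
move=> C0 h; rewrite leNgt; apply/negP => Ca.
have a0 : 0 < a by apply: lt_trans Ca.
(* An explicit value in place of a limit at 0: it gives [e * C < 1] and turns
   [(1 + e * a) * (1 - e * C)] into [1 + e * (a - C) / 2], which exceeds 1. *)
pose e := (a - C) / (2 * a * C).
have aC : 0 < a - C by rewrite subr_gt0.
have e0 : 0 < e by rewrite divr_gt0// ?mulr_gt0.
have he := h _ e0; have hm := expR_ge1Dx (- (e * C)).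
have eC : e * C = (a - C) / (2 * a) by rewrite /e; field; rewrite !gt_eqF.
have eC1 : e * C < 1.
  by rewrite eC ltr_pdivrMr ?mulr_gt0// mul1r; lra.
have hprod : (1 + e * a) * (1 - e * C) <= 1.
  apply: (@le_trans _ _ (expR (e * C) * expR (- (e * C)))).
    by apply: ler_pM => //; rewrite ?subr_ge0 ?(ltW eC1)// addr_ge0// mulr_ge0// ltW.
  by rewrite -expRD subrr expR0.
have ee : (1 + e * a) * (1 - e * C) = 1 + e * (a - C) / 2.
  have -> : (1 + e * a) * (1 - e * C) = 1 + e * (a - C - a * (e * C)) by ring.
  by rewrite eC; field; rewrite gt_eqF.
have : 0 < e * (a - C) / 2 by rewrite divr_gt0// mulr_gt0.
by move: hprod; rewrite ee; lra.
Qed.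

Lemma ln2_ge_half (R : realType) : 2^-1 <= ln 2 :> R.
Proof.
have := @ln_le_subr1 R 2^-1; rewrite lnV ?posrE// invr_gt0 ltr0n => /(_ isT); lra.
Qed.

Lemma bernoulli_ineq (R : realFieldType) (e : R) (m : nat) : 0 <= e ->
  1 + e * m%:R <= (1 + e) ^+ m.
Proof.
move=> e0; elim: m => [|m IH]; first by rewrite mulr0 addr0 expr0.
rewrite exprS; apply: le_trans (ler_wpM2l _ IH); last by rewrite addr_ge0.
have : 0 <= e * (e * m%:R) by rewrite !mulr_ge0.
by rewrite -natr1; lra.
Qed.

Theorem mainTheorem2 (R : realType) (d : measure_display) (T : measurableType d)
  (P : probability T R) (n : nat) (sigma : R) (mu : 'I_n -> R)
  (xi : 'I_n -> {RV P >-> R}) :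
  (0 < n)%N -> 0 < sigma -> monotone_cone mu ->
  (* each xi_i has law N(0, sigma^2) *)
  (forall (i : 'I_n) (A : set R), measurable A ->
     P (xi i @^-1` A) = normal_prob 0 sigma A) ->
  (* xi_1, ..., xi_n are mutually independent *)
  (forall B : 'I_n -> set R, (forall i, measurable (B i)) ->
     P [set w | forall i, B i (xi i w)] = (\prod_(i < n) P (xi i @^-1` B i))%E) ->
  let khat := fun w : T => nb_distinct (mono_proj (fun i => mu i + xi i w)) in
  let k := (nb_distinct mu)%:R : R in
  (forall gamma : R, 0 < gamma < 1 ->
     ((1 - gamma)%:E <=
       P [set w | ((khat w)%:R <=
                  2 * k * ln (expR 1 * n%:R / k) + 7 * ln (gamma^-1))%R])%E) /\
  ('E_P[fun w => (khat w)%:R : R] <= (k * ln (expR 1 * n%:R / k))%:E)%E.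
Proof.
move=> n0 _ mmu xi_law xi_indep khat k.
have [ms [hruns hsize hsum hpos]] : exists ms, [/\ runs R _ mu ms (enum 'I_n),
    size ms = nb_distinct mu, sumn ms = n & all (fun m => 0 < m)%N ms].
  have [|ms [h1 h2 h3 h4]] := runs_exist R _ mu (enum 'I_n).
    have : sorted leq (map val (enum 'I_n)) by rewrite val_enum_ord iota_sorted.
    by rewrite sorted_map; apply: sub_sorted => i j; apply: mmu.
  by exists ms; rewrite h3 size_enum_ord.
set C := k * ln _.
have ms0 : ms != [::] by apply: contraTneq n0 => e; rewrite -hsum e.
have C0 : 0 < C.
  rewrite /C /k -hsize -hsum; apply: lt_le_trans (sum_ln_le R ms hpos ms0).
  case: ms ms0 hpos {hruns hsize hsum} => [//|m ms] _ /allP hpos.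
  have h1 m' : m' \in m :: ms -> 0 <= 1 + ln m'%:R :> R.
    by move=> /hpos m0; rewrite addr_ge0// ln_ge0// ler1n.
  rewrite big_cons big_seq ltr_pwDl ?sumr_ge0// => [|i ims].
    by rewrite ltr_pwDl// ln_ge0// ler1n hpos// mem_head.
  by apply: h1; rewrite inE ims orbT.
have mk : measurable_fun setT khat.
  rewrite (_ : khat = fun w => nb_faces (fun i => mu i + xi i w) (enum 'I_n)).
    apply: measurable_nb_faces => i; apply: measurable_funD; first exact: measurable_cst.
    exact: measurable_funPT.
  by apply/funext => w; rewrite /khat nb_distinct_mono_proj.
have mpow z : measurable_fun setT (fun w => z ^+ khat w : R).
  exact: (measurable_natfun _ _ _ (fun j => z ^+ j)).
(* Splitting into the constant pieces of [mu] can only raise the face count, and on each piece only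
   the noise remains. *)
have khat_mgf z : 1 <= z ->
    (\int[P]_w (z ^+ khat w)%:E <= (expR ((z - 1) * C))%:E)%E.
  move=> z1; have := integral_piece_faces_le R d T P n (normal_prob 0 sigma)
    xi xi_law xi_indep z ms z1 hsum hpos n0.
  rewrite hsize; apply: le_trans; apply: ge0_le_integral => //.
  - by move=> w _; rewrite lee_fin exprn_ge0//; apply: le_trans z1.
  - exact/measurable_EFinP.
  - apply/measurable_EFinP; apply: (measurable_natfun _ _ _ (fun j => z ^+ j)).
    by apply: measurable_piece_faces => i; exact: measurable_funPT.
  - move=> w _; rewrite lee_fin ler_weXn2l// /khat nb_distinct_mono_proj.
    rewrite -(piece_faces_runs R _ mu _ _ _ (enum_uniq _) hruns).
    by apply: nb_faces_le_piece_faces; rewrite hsum size_enum_ord.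
split=> [gamma /andP[g0 g1]|].
  rewrite -mulrA -/C; set c := 2 * C + _.
  set A := [set w | c < (khat w)%:R].
  have mA : measurable A.
    have -> : A = khat @^-1` [set j | c < j%:R] by [].
    by rewrite -[X in measurable X]setTI; apply: mk.
  rewrite (_ : [set w | _] = ~` A); last first.
    by apply/seteqP; split=> w; rewrite /A /= leNgt => /negP.
  rewrite probability_setC//.
  (* Markov's inequality for [2 ^+ khat], which is at least [expR (c * ln 2)] on [A]. *)
  have hA : ((expR (c * ln 2))%:E * P A <= (expR C)%:E)%E.
    rewrite -integral_cst//; have := khat_mgf 2; rewrite (_ : 2 - 1 = 1) ?mul1r; last by ring.
    move=> /(_ _); rewrite ler1n => /(_ isT); apply: le_trans.
    apply: (@le_trans _ _ (\int[P]_(w in A) (2 ^+ khat w)%:E)%E).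
      apply: ge0_le_integral => //.
      - by move=> w _; rewrite /= lee_fin expR_ge0.
      - by apply/measurable_EFinP; apply: measurable_funTS.
      - move=> w Aw; rewrite /= lee_fin -[X in _ <= X]lnK ?posrE ?exprn_gt0//.
        by rewrite ler_expR lnXn// -[ln 2 *+ _]mulr_natl ler_wpM2r ?(ltW Aw)// ln_ge0// ler1n.
    apply: ge0_subset_integral => //.
    exact/measurable_EFinP.
  have PA : (P A <= gamma%:E)%E.
    have hfin : P A \is a fin_num by apply: fin_num_measure.
    move: hA; rewrite -(fineK hfin) -EFinM !lee_fin => hA.
    have : fine (P A) <= expR (C - c * ln 2).
      by rewrite expRD expRN mulrC mulrC ler_pdivlMr ?expR_gt0// mulrC.
    move=> /le_trans; apply; rewrite -[leRHS]lnK ?posrE// ler_expR.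
    (* Since [ln 2] is at least one half, [2 * C * ln 2] covers [C] and [7 * ln 2] is at least 1, so
       the exponent is at most [ln gamma]. *)
    rewrite /c lnV ?posrE//.
    have := ln_lt0 (introT andP (conj g0 g1)); have := ln2_ge_half R.
    by move: C0; move: (ln gamma) (ln 2) => u v; nra.
  have -> : (1 - gamma)%:E = (1 - gamma%:E)%E :> \bar R by [].
  by apply: leeB.
rewrite unlock.
set E := (\int[P]_w _)%E.
have mkR : measurable_fun setT (fun w => (khat w)%:R : R).
  exact: (measurable_natfun _ _ _ (fun j => j%:R)).
(* By Bernoulli's inequality [(1 + e) ^+ khat] dominates [1 + e * khat]. *)
have bound e : 0 < e -> (1 + e%:E * E <= (expR (e * C))%:E)%E.
  move=> e0; have := khat_mgf (1 + e); rewrite lerDl (ltW e0) => /(_ isT).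
  rewrite (_ : 1 + e - 1 = e); last by ring.
  apply: le_trans.
  rewrite /E -ge0_integralZl//; last 2 first.
  - exact/measurable_EFinP.
  - by rewrite lee_fin ltW.
  rewrite -[X in (X + _)%E](_ : \int[P]_w (cst 1%E w) = 1%E)%E; last first.
    by rewrite integral_cst// mul1e; apply: probability_setT.
  rewrite -ge0_integralD//; last 2 first.
  - by move=> w _; rewrite mule_ge0 ?lee_fin// ltW.
  - by apply: measurable_funeM; exact/measurable_EFinP.
  apply: ge0_le_integral => //.
  - by move=> w _; rewrite adde_ge0// mule_ge0 ?lee_fin// ltW.
  - by apply: emeasurable_funD => //; apply: measurable_funeM; exact/measurable_EFinP.
  - exact/measurable_EFinP.
  - move=> w _ /=; rewrite -EFinM -EFinD lee_fin.
    exact/bernoulli_ineq/ltW.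
have E0 : (0 <= E)%E by apply: integral_ge0 => w _; rewrite lee_fin.
(* The case [e = 1] already shows that the mean is finite, so the rest takes place in the reals. *)
have Efin : E \is a fin_num.
  rewrite ge0_fin_numE//; apply: le_lt_trans (ltry (expR (1 * C))).
  by apply: le_trans (bound 1 ltr01); rewrite mul1e leeDr.
rewrite -(fineK Efin) lee_fin; apply: le_of_expR_bound => // e /bound.
by rewrite -(fineK Efin) -EFinM -EFinD lee_fin.
Qed.
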